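(* Let $t\in\mathbb{C}$ be an $8$th root of unity and let $a,c,d\in\mathbb{C}$ satisfy $c=a^2-ad+d^2$, $c\neq0$ and $a\neq d$. Let $\rho=\rho(-1,t,a,c,d):\mathcal{NB}_4\to GL(2,\mathbb{C})$ be the corresponding irreducible representation of the necklace braid group $\mathcal{NB}_4$. Then there exists a hermitian positive definite matrix $M$ such that $\rho$ is unitary relative to $M$ if and only if $|a|<1$ and there exists $\theta\in\mathbb{R}$ such that $a=d+e^{i\theta}$ and $$\left\{\begin{array}{ll} d=\delta'-\frac12 i \text{ for some }\delta'\in\mathbb{R} & \text{if }\theta\equiv\frac{\pi}{2}\ (\mathrm{mod}\ 2\pi),\\ d=\delta'+\frac12 i \text{ for some }\delta'\in\mathbb{R} & \text{if }\theta\equiv-\frac{\pi}{2}\ (\mathrm{mod}\ 2\pi),\\ d=-\frac12\sec\theta-(\tan\theta)\,\delta+i\delta \text{ for some }\delta\in\mathbb{R} & \text{if }\theta\not\equiv\pm\frac{\pi}{2}\ (\mathrm{mod}\ 2\pi).\end{array}\right.$$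
   Context: The necklace braid group $\mathcal{NB}_n$ is the group with generators $\sigma_1,\dots,\sigma_n,\tau$ and relations (indices taken modulo $n$, so $\sigma_{n+1}=\sigma_1$): $\sigma_i\sigma_{i+1}\sigma_i=\sigma_{i+1}\sigma_i\sigma_{i+1}$; $\sigma_i\sigma_j=\sigma_j\sigma_i$ whenever $i-j\not\equiv\pm1 \pmod n$; $\tau\sigma_i\tau^{-1}=\sigma_{i+1}$; $\tau^{2n}=1$. For the parameters considered, $\rho(T,t,a,c,d)$ denotes the representation of $\mathcal{NB}_n$ on $\mathbb{C}^2$ with $\tau\mapsto\begin{pmatrix}Tt&0\\0&t\end{pmatrix}$ and $\sigma_i\mapsto\begin{pmatrix}a&T^{i-1}\\ cT^{1-i}&d\end{pmatrix}$ for $1\le i\le n$ (here $n=4$). A square matrix $A$ is unitary relative to a matrix $M$ if $AMA^*=M$, where $A^*$ is the conjugate transpose of $A$. A representation $\rho$ of a group $G$ is unitary relative to $M$ if $\rho(g)$ is unitary relative to $M$ for every $g\in G$. *)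

(* Defs.v *)
From HB Require Import structures.
From mathcomp Require Import all_boot all_order all_algebra.
From mathcomp Require Import generic_quotient sesquilinear spectral.
From mathcomp Require Import boolp reals trigo.
From mathcomp Require Import complex ring.

Set Implicit Arguments.
Unset Strict Implicit.
Unset Printing Implicit Defensive.

Import Order.TTheory GRing.Theory Num.Theory.

Local Open Scope quotient_scope.
Local Open Scope ring_scope.
Local Open Scope complex_scope.
Local Open Scope sesquilinear_scope.

(* Words over the letters x, coded as (x, true), and x^-1, coded as
   (x, false). *)
Definition word (X : choiceType) := seq (X * bool).

Definition letter_inv (X : choiceType) (l : X * bool) := (l.1, ~~ l.2).

Definition word_inv (X : choiceType) (w : word X) : word X :=
  rev (map (@letter_inv X) w).

(* The least congruence on words that contains E and the equations
   l l^-1 = 1, for l a generator or the inverse of a generator. *)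
Inductive word_eqv (X : choiceType) (E : word X -> word X -> Prop) :
    word X -> word X -> Prop :=
| WRel u v : E u v -> word_eqv E u v
| WCancel l : word_eqv E [:: l; letter_inv l] [::]
| WRefl u : word_eqv E u u
| WSym u v : word_eqv E u v -> word_eqv E v u
| WTrans u v w : word_eqv E u v -> word_eqv E v w -> word_eqv E u w
| WCat u u' v v' : word_eqv E u u' -> word_eqv E v v' ->
    word_eqv E (u ++ v) (u' ++ v').

Section Presentation.
Variables (X : choiceType) (E : word X -> word X -> Prop).

Definition word_eqb (u v : word X) : bool := `[< word_eqv E u v >].

Lemma word_eqb_refl : reflexive word_eqb.
Proof. by move=> u; apply/asboolP; exact: WRefl. Qed.

Lemma word_eqb_sym : symmetric word_eqb.
Proof. by move=> u v; apply/asboolP/asboolP => /WSym. Qed.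

Lemma word_eqb_trans : transitive word_eqb.
Proof.
by move=> v u w /asboolP uv /asboolP vw; apply/asboolP; exact: WTrans vw.
Qed.

Canonical word_equiv :=
  EquivRel word_eqb word_eqb_refl word_eqb_sym word_eqb_trans.

(* The group < X | E >. *)
Definition presented := {eq_quot word_equiv}.

HB.instance Definition _ := EqQuotient.on presented.
HB.instance Definition _ := Choice.on presented.

Definition word_class (w : word X) : presented := \pi w.

Lemma word_classE u v : word_class u = word_class v <-> word_eqv E u v.
Proof.
split; first by move/eqmodP/asboolP.
by move=> uv; apply/eqmodP/asboolP.
Qed.

Lemma word_classK (x : presented) : word_class (repr x) = x.
Proof. exact: reprK. Qed.

Lemma repr_class w : word_eqv E (repr (word_class w)) w.
Proof. by apply/word_classE; rewrite word_classK. Qed.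

Lemma word_invK : involutive (@word_inv X).
Proof.
move=> w; rewrite /word_inv map_rev revK -map_comp -[RHS]map_id.
by apply: eq_map => -[x b]; rewrite /letter_inv /= negbK.
Qed.

Lemma word_eqv_invr w : word_eqv E (w ++ word_inv w) [::].
Proof.
elim: w => [|l w IH]; first exact: WRefl.
have -> : (l :: w) ++ word_inv (l :: w) =
    [:: l] ++ ((w ++ word_inv w) ++ [:: letter_inv l]).
  by rewrite /word_inv /= rev_cons -cats1 !catA.
apply: WTrans (WCancel E l); rewrite -[[:: l; _]]cat1s.
apply: WCat; first exact: WRefl.
by rewrite -[X in word_eqv _ _ X]cat0s; apply: WCat IH (WRefl _ _).
Qed.

Lemma word_eqv_invl w : word_eqv E (word_inv w ++ w) [::].
Proof. by rewrite -{2}[w]word_invK; exact: word_eqv_invr. Qed.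

Lemma word_inv_eqv u v : word_eqv E u v -> word_eqv E (word_inv u) (word_inv v).
Proof.
move=> uv; apply: (@WTrans _ _ _ (word_inv u ++ (v ++ word_inv v))).
  rewrite -[X in word_eqv _ X _]cats0; apply: WCat; first exact: WRefl.
  exact/WSym/word_eqv_invr.
rewrite catA -[X in word_eqv _ _ X]cat0s; apply: WCat; last exact: WRefl.
apply: WTrans (word_eqv_invl u).
by apply: WCat; [exact: WRefl|exact: WSym].
Qed.

Definition pres_one : presented := word_class [::].
Definition pres_mul (x y : presented) : presented :=
  word_class (repr x ++ repr y).
Definition pres_inv (x : presented) : presented :=
  word_class (word_inv (repr x)).

Lemma pres_mulE u v :
  pres_mul (word_class u) (word_class v) = word_class (u ++ v).
Proof. by apply/word_classE; apply: WCat; exact: repr_class. Qed.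

Lemma pres_invE u : pres_inv (word_class u) = word_class (word_inv u).
Proof. by apply/word_classE; apply: word_inv_eqv; exact: repr_class. Qed.

Lemma pres_mulA : associative pres_mul.
Proof.
move=> x y z; rewrite -(word_classK x) -(word_classK y) -(word_classK z).
by rewrite !pres_mulE catA.
Qed.

Lemma pres_mul1 : left_id pres_one pres_mul.
Proof. by move=> x; rewrite -(word_classK x) pres_mulE. Qed.

Lemma pres_mulr1 : right_id pres_one pres_mul.
Proof. by move=> x; rewrite -(word_classK x) pres_mulE cats0. Qed.

Lemma pres_mulrV : right_inverse pres_one pres_inv pres_mul.
Proof.
move=> x; rewrite -(word_classK x) pres_invE pres_mulE.
exact/word_classE/word_eqv_invr.
Qed.

Lemma pres_mulVr : left_inverse pres_one pres_inv pres_mul.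
Proof.
move=> x; rewrite -(word_classK x) pres_invE pres_mulE.
exact/word_classE/word_eqv_invl.
Qed.

HB.instance Definition _ := isGroup.Build presented
  pres_mulA pres_mul1 pres_mulr1 pres_mulVr pres_mulrV.

Definition word_eval (H : groupType) (f : X -> H) (w : word X) : H :=
  (\prod_(l <- w) (if l.2 then f l.1 else (f l.1)^-1))%g.

Lemma word_eval_eqv (H : groupType) (f : X -> H) u v :
    (forall u v, E u v -> word_eval f u = word_eval f v) ->
  word_eqv E u v -> word_eval f u = word_eval f v.
Proof.
move=> fE; elim=> {u v} [u v /fE //|[x []]|//|//|u v w _ -> _ -> //|].
- by rewrite /word_eval !big_cons !big_nil mulg1 mulgV.
- by rewrite /word_eval !big_cons !big_nil mulg1 mulVg.
- by move=> u u' v v' _ + _; rewrite /word_eval !big_cat /= => -> ->.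
Qed.

Lemma presented_lift (H : groupType) (f : X -> H) :
    (forall u v, E u v -> word_eval f u = word_eval f v) ->
  exists rho : {multiplicative presented -> H},
    forall x, rho (word_class [:: (x, true)]) = f x.
Proof.
move=> fE; pose r (x : presented) := word_eval f (repr x).
have rE w : r (word_class w) = word_eval f w.
  by apply: word_eval_eqv => //; exact: repr_class.
have rM : {morph r : x y / (x * y)%g}.
  move=> x y; rewrite -[x]word_classK -[y]word_classK.
  rewrite [(_ * _)%g]pres_mulE !rE; exact: big_cat.
pose m := isMultiplicative.Build presented H r rM.
pose rho : {multiplicative presented -> H} := HB.pack r m.
exists rho => x; rewrite /rho /= rE.
by rewrite /word_eval big_cons big_nil mulg1.
Qed.

End Presentation.

(* The generators of NB_n: Some i is sigma_(i+1), for i in {0, ..., n - 1},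
   and None is tau. *)
Definition necklace_gen (n : nat) : choiceType := option 'I_n.

Definition sgen n (i : 'I_n) : necklace_gen n * bool := (Some i, true).
Definition tgen n : necklace_gen n * bool := (None, true).

(* ordS i is the successor of i modulo n. *)
Inductive necklace_rel (n : nat) :
    word (necklace_gen n) -> word (necklace_gen n) -> Prop :=
| NBraid (i : 'I_n) :
    necklace_rel [:: sgen i; sgen (ordS i); sgen i]
                 [:: sgen (ordS i); sgen i; sgen (ordS i)]
| NFar (i j : 'I_n) : i != ordS j -> j != ordS i ->
    necklace_rel [:: sgen i; sgen j] [:: sgen j; sgen i]
| NShift (i : 'I_n) :
    necklace_rel [:: tgen n; sgen i; letter_inv (tgen n)] [:: sgen (ordS i)]
| NTorsion : necklace_rel (nseq (2 * n) (tgen n)) [::].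

Definition NB (n : nat) : groupType := presented (@necklace_rel n).

Definition sigma n (i : 'I_n) : NB n :=
  word_class (@necklace_rel n) [:: sgen i].
Definition tau n : NB n := word_class (@necklace_rel n) [:: tgen n].

Section GeneralLinear.
Variables (n : nat) (K : fieldType).

Record GL := MkGL { GLmx : 'M[K]_n; GLmxP : GLmx \in unitmx }.

HB.instance Definition _ := [isSub for GLmx].
HB.instance Definition _ := [Choice of GL by <:].

Definition GL_one := MkGL (unitmx1 K n).
Definition GL_inv (x : GL) :=
  @MkGL (invmx (GLmx x)) (etrans (unitmx_inv (GLmx x)) (GLmxP x)).

Lemma GL_mul_subproof (x y : GL) : GLmx x *m GLmx y \in unitmx.
Proof. by rewrite unitmx_mul !GLmxP. Qed.

Definition GL_mul (x y : GL) := MkGL (GL_mul_subproof x y).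

Lemma GL_mulA : associative GL_mul.
Proof. by move=> x y z; apply: val_inj; exact: mulmxA. Qed.

Lemma GL_mul1 : left_id GL_one GL_mul.
Proof. by move=> x; apply: val_inj; exact: mul1mx. Qed.

Lemma GL_mulr1 : right_id GL_one GL_mul.
Proof. by move=> x; apply: val_inj; exact: mulmx1. Qed.

Lemma GL_mulV : left_inverse GL_one GL_inv GL_mul.
Proof. by move=> x; apply: val_inj; exact: mulVmx (GLmxP x). Qed.

Lemma GL_mulrV : right_inverse GL_one GL_inv GL_mul.
Proof. by move=> x; apply: val_inj; exact: mulmxV (GLmxP x). Qed.

HB.instance Definition _ := isGroup.Build GL
  GL_mulA GL_mul1 GL_mulr1 GL_mulV GL_mulrV.

End GeneralLinear.

Arguments GL : clear implicits.

Definition mx2 (K : nzRingType) (x y z w : K) : 'M[K]_2 :=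
  \matrix_(i, j) if i == 0 then if j == 0 then x else y
                 else if j == 0 then z else w.

(* rho is the representation rho(T, t, a, c, d) of NB_n; with indices starting
   at 0, the exponents i - 1 and 1 - i become i and - i. *)
Definition is_necklace_rep n (K : fieldType) (T t a c d : K)
    (rho : {multiplicative NB n -> GL 2 K}) : Prop :=
  GLmx (rho (tau n)) = mx2 (T * t) 0 0 t /\
  forall i : 'I_n, GLmx (rho (sigma i)) = mx2 a (T ^+ i) (c * T ^- i) d.

(* GL(m, K) acts on column vectors; the rows of U span a subspace of K^m. *)
Definition irreducible_rep (G : groupType) m (K : fieldType)
    (rho : {multiplicative G -> GL m K}) : Prop :=
  forall U : 'M[K]_m, (forall g, (U *m (GLmx (rho g))^T <= U)%MS) ->
  U = 0 \/ row_full U.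

Definition hermitian_posdef m (C : numClosedFieldType) (M : 'M[C]_m) : Prop :=
  M \is hermsymmx /\ forall v : 'cV[C]_m, v != 0 -> 0 < (v^t* *m M *m v) 0 0.

Definition unitary_rel m (C : numClosedFieldType) (A M : 'M[C]_m) : Prop :=
  A *m M *m A^t* = M.

Definition unitary_rep_rel (G : groupType) m (C : numClosedFieldType)
    (rho : {multiplicative G -> GL m C}) (M : 'M[C]_m) : Prop :=
  forall g, unitary_rel (GLmx (rho g)) M.

Definition expi (R : realType) (x : R) : R[i] := cos x +i* sin x.

Definition sec (R : realType) (x : R) : R := (cos x)^-1.

Definition eqmod2pi (R : realType) (x y : R) : Prop :=
  exists k : int, x = y + k%:~R * (2 * pi).

Lemma mx2P (K : nzRingType) (A B : 'M[K]_2) :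
  A 0 0 = B 0 0 -> A 0 1 = B 0 1 -> A 1 0 = B 1 0 -> A 1 1 = B 1 1 -> A = B.
Proof.
move=> e00 e01 e10 e11; apply/matrixP.
have o2 (i : 'I_2) : i = 0 \/ i = 1.
  by case: i => -[|[|//]] p; [left|right]; exact/val_inj.
by move=> i j; case: (o2 i) => ->; case: (o2 j) => ->.
Qed.

Lemma mul_mx2 (K : nzRingType) (x y z w x' y' z' w' : K) :
  mx2 x y z w *m mx2 x' y' z' w' =
  mx2 (x * x' + y * z') (x * y' + y * w') (z * x' + w * z') (z * y' + w * w').
Proof. by apply: mx2P; rewrite !mxE !big_ord_recl big_ord0 !mxE /= addr0. Qed.

Lemma mx2_unit (K : fieldType) (x y z w : K) :
  (mx2 x y z w \in unitmx) = (x * w - y * z != 0).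
Proof. by rewrite unitmxE unitfE (expand_det_row _ 0) !big_ord_recl big_ord0 /cofactor
  !det_mx11 !mxE /= addr0 mul1r mulN1r mulrN. Qed.

Lemma necklace_rep_exists (K : fieldType) (t a c d : K) :
    t ^+ 8 = 1 -> c = a ^+ 2 - a * d + d ^+ 2 -> a != d ->
  exists rho : {multiplicative NB 4 -> GL 2 K},
    is_necklace_rep (-1) t a c d rho.
Proof.
move=> t8 cE ad; have t0 : t != 0.
  by apply/eqP => te; move/eqP: t8; rewrite te expr0n eq_sym oner_eq0.
have tu : mx2 (-1 * t) 0 0 t \in unitmx.
  by rewrite mx2_unit mulr0 subr0 mulf_neq0 // mulN1r oppr_eq0.
have sT (i : nat) : (-1 : K) ^- i = (-1) ^+ i.
  by rewrite -exprVn invrN1.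
have su (i : 'I_4) : mx2 a ((-1) ^+ i) (c * (-1) ^- i) d \in unitmx.
  rewrite mx2_unit sT mulrCA -exprD addnn -mul2n exprM sqrrN expr1n expr1n.
  rewrite mulr1 cE.
  have -> : a * d - (a ^+ 2 - a * d + d ^+ 2) = - (a - d) ^+ 2 by ring.
  by rewrite oppr_eq0 expf_neq0 // subr_eq0.
pose f (x : necklace_gen 4) : GL 2 K :=
  if x is Some i then MkGL (su i) else MkGL tu.
have o4 (i : 'I_4) : (-1 : K) ^+ ordS i = - (-1) ^+ i.
  by case: i => -[|[|[|[|//]]]] p; rewrite /= /ordS /=; ring.
have sq (i : 'I_4) : (-1 : K) ^+ i * (-1) ^+ i = 1.
  by rewrite -exprD addnn -mul2n exprM sqrrN expr1n expr1n.
have e1 (i : 'I_4) : (-1 : K) ^+ i = 1 \/ (-1 : K) ^+ i = -1.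
  by rewrite -signr_odd; case: odd; [right|left].
have [u v uv|rho rhoE] := @presented_lift _ (@necklace_rel 4) _ f.
  case: uv => [i|i j ij ji|i|]; rewrite /word_eval.
  - rewrite !big_cons !big_nil !mulg1; apply: val_inj => /=.
    rewrite !sT !o4 !mul_mx2.
    case: (e1 i) => ->; apply: mx2P; rewrite !mxE /= cE; ring.
  - rewrite !big_cons !big_nil !mulg1; apply: val_inj => /=.
    suff -> : (-1 : K) ^+ i = (-1) ^+ j by [].
    by case: i j ij ji => -[|[|[|[|//]]]] p [] [|[|[|[|//]]]] q //= _ _; ring.
  - rewrite !big_cons !big_nil !mulg1; apply: (mulIg (f None)).
    rewrite /= mulgA mulgVK; apply: val_inj => /=.
    by rewrite !sT !o4 !mul_mx2; apply: mx2P; rewrite !mxE /=; ring.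
  - rewrite big_nil (_ : nseq _ _ = nseq 8 (tgen 4)) // !big_cons big_nil mulg1.
    apply: val_inj => /=; rewrite !mul_mx2.
    apply: mx2P; rewrite !mxE /= ?mulr1n ?mulr0n; try ring.
      by rewrite -[RHS]t8; ring.
    by rewrite -[RHS]t8; ring.
by exists rho; split=> [|i]; rewrite rhoE.
Qed.

Lemma necklace_rep_irreducible (K : numFieldType) (t a c d : K)
    (rho : {multiplicative NB 4 -> GL 2 K}) :
    t ^+ 8 = 1 -> c != 0 -> is_necklace_rep (-1) t a c d rho ->
  irreducible_rep rho.
Proof.
move=> t8 c0 [rhot rhos] U Ust.
have t0 : t != 0.
  by apply/eqP => te; move/eqP: t8; rewrite te expr0n eq_sym oner_eq0.
have := Ust (sigma (0 : 'I_4)); have := Ust (tau 4).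
rewrite {}rhot {}rhos /= !expr0 invr1 mulr1 mulN1r.
set D := mx2 _ _ _ _; set S := mx2 _ _ _ _ => UD US.
have US' (w : 'rV_2) : (w <= U)%MS -> (w *m S^T <= U)%MS.
  by move=> wU; apply: submx_trans US; exact: submxMr.
pose e (i : 'I_2) : 'rV[K]_2 := delta_mx 0 i.
have eU (w : 'rV_2) i : (w <= U)%MS -> w 0 i != 0 -> (e i <= U)%MS.
  move=> wU wi; have sgn : (i == 0) || (i == 1) by case: i {wi} => -[|[|]].
  pose s : K := if i == 0 then -1 else 1.
  suff -> : e i = (2 * t * w 0 i)^-1 *: (t *: w + s *: (w *m D^T)).
    rewrite scalemx_sub // addmx_sub ?scalemx_sub //.
    by apply: submx_trans UD; exact: submxMr.
  apply/rowP => j; rewrite !mxE !big_ord_recl big_ord0 !mxE /= {}/s.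
  have k0 : 2 * t * w 0 i != 0 by rewrite !mulf_neq0 // pnatr_eq0.
  apply: (mulfI k0); rewrite mulVKf //.
  have -> : lift ord0 ord0 = 1 :> 'I_2 by exact: val_inj.
  have -> : ord0 = 0 :> 'I_2 by exact: val_inj.
  have : (j == 0) || (j == 1) by case: j => -[|[|]].
  by case/orP: sgn => /eqP ->; case/orP=> /eqP -> /=; ring.
have [U0|[i [j Uij]]] : U = 0 \/ exists i j, U i j != 0.
  have [->|/matrix0Pn[i [j Uij]]] := eqVneq U 0; first by left.
  by right; exists i, j.
  by left.
right; have jU : (e j <= U)%MS.
  by apply: (eU (row i U)); [exact: row_sub|rewrite mxE].
have both k : (e k <= U)%MS.
  have [->//|kj] := eqVneq k j.
  apply: (eU _ _ (US' _ jU)); rewrite -rowE !mxE.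
  have : (j == 0) || (j == 1) by case: (j) => -[|[|]].
  have : (k == 0) || (k == 1) by case: (k) => -[|[|]].
  by case/orP=> /eqP ke; case/orP=> /eqP je; rewrite ke je // in kj *;
    rewrite /= ?oner_neq0.
by rewrite -sub1mx; apply/row_subP => k; rewrite row1.
Qed.

(* Main.v *)
(* Unitarity of the image of tau forces M = diag(p, q), with p, q > 0. Writing
   z' for the conjugate of z, the equations for the sigma_i then read
   p |a|^2 + q = p, p a c' + q d' = 0 and p |c|^2 + q |d|^2 = q. Since the
   determinant of the image of sigma_i is - (a - d)^2, they give |a - d| = 1.
   With u = a - d = e^(i theta) we have c = u^2 + a d, so the second equation
   becomes u'^2 a + d' = 0, i.e. 2 Re (d u') = -1. Conversely, when |a| < 1,
   M = diag(1, 1 - |a|^2) works. *)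

Require Import Defs.
From HB Require Import structures.
From mathcomp Require Import all_boot all_order all_algebra.
From mathcomp Require Import boolp reals trigo.
From mathcomp Require Import complex.
From mathcomp Require Import sesquilinear spectral ring lra.

Import Order.TTheory GRing.Theory Num.Theory.
Local Open Scope ring_scope.
Local Open Scope complex_scope.

(** * Induction over a presented group *)

Section PresentedGenerators.
Variables (X : choiceType) (E : word X -> word X -> Prop).

(** Induction on a representative word: its head letter is a generator or the inverse of one, and
    its tail is covered by the induction hypothesis. *)
Lemma presented_ind (P : presented E -> Prop) :
    P 1%g -> (forall x y, P x -> P y -> P (x * y)%g) ->
    (forall x, P x -> P x^-1%g) ->
    (forall x, P (word_class E [:: (x, true)])) ->
  forall x, P x.
Proof.
move=> P1 PM PV PX x; rewrite -[x]word_classK.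
elim: (repr x) => [//|[y b] w IH].
rewrite -cat1s -pres_mulE; apply: PM IH.
case: b; first exact: PX.
by rewrite -(pres_invE E [:: (y, true)]); exact/PV/PX.
Qed.

End PresentedGenerators.

(** * Matrices preserving a sesquilinear form *)

Section UnitaryRel.
Variables (m : nat) (C : numClosedFieldType).
Implicit Types A B M : 'M[C]_m.

Lemma unitary_rel1 M : unitary_rel 1%:M M.
Proof. by rewrite /unitary_rel mul1mx trmx1 map_mx1 mulmx1. Qed.

Lemma unitary_relM A B M :
  unitary_rel A M -> unitary_rel B M -> unitary_rel (A *m B) M.
Proof.
rewrite /unitary_rel => AM BM.
by rewrite trmx_mul map_mxM !mulmxA -[in RHS]AM -[in RHS]BM !mulmxA.
Qed.

Lemma unitary_relV A M :
  A \in unitmx -> unitary_rel A M -> unitary_rel (invmx A) M.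
Proof.
rewrite /unitary_rel => uA AM.
rewrite -[in LHS]AM !mulmxA mulVmx // mul1mx -mulmxA -map_mxM -trmx_mul.
by rewrite mulVmx // trmx1 map_mx1 mulmx1.
Qed.

(** The invertible matrices unitary relative to [M] are closed under products and inverses, so
    checking the generators is enough. *)
Lemma unitary_rep_generators (X : choiceType) (E : word X -> word X -> Prop)
    (rho : {multiplicative presented E -> GL m C}) M :
    (forall x, unitary_rel (GLmx (rho (word_class E [:: (x, true)]))) M) ->
  unitary_rep_rel rho M.
Proof.
move=> gens; have rho1 : rho 1%g = 1%g.
  by apply: (mulgI (rho 1%g)); rewrite -gmulfM !mulg1.
have rhoV x : rho x^-1%g = (rho x)^-1%g.
  by apply: (mulgI (rho x)); rewrite -gmulfM !mulgV.
apply: (@presented_ind _ _ (fun g => unitary_rel (GLmx (rho g)) M)) => //.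
- by rewrite rho1; exact: unitary_rel1.
- by move=> x y xM yM; rewrite gmulfM; exact: unitary_relM.
- by move=> x xM; rewrite rhoV; apply: unitary_relV => //; exact: GLmxP.
Qed.

End UnitaryRel.

(** * Unitarity equations in dimension two *)

Section TwoByTwo.
Variable C : numClosedFieldType.
Implicit Types a c d p q s t u x y z w : C.
Local Notation "z ^*" := (Num.conj z).

Lemma trmxC_mx2 x y z w :
  map_mx Num.conj (mx2 x y z w)^T = mx2 x^* z^* y^* w^*.
Proof. by apply: mx2P; rewrite !mxE. Qed.

Lemma unitary_rel_mx2 x y z w p q :
  unitary_rel (mx2 x y z w) (mx2 p 0 0 q) <->
  [/\ p * (x * x^*) + q * (y * y^*) = p, p * (x * z^*) + q * (y * w^*) = 0,
      p * (z * x^*) + q * (w * y^*) = 0 & p * (z * z^*) + q * (w * w^*) = q].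
Proof.
rewrite /unitary_rel trmxC_mx2 !mul_mx2 !mulr0 !add0r !addr0.
split=> [/matrixP e | [e00 e01 e10 e11]].
  have := (e 0 0, e 0 1, e 1 0, e 1 1); rewrite !mxE /=.
  case=> [[[h1 h2] h3] h4]; split.
  - by rewrite -[RHS]h1; ring.
  - by rewrite -[RHS]h2; ring.
  - by rewrite -[RHS]h3; ring.
  - by rewrite -[RHS]h4; ring.
apply: mx2P; rewrite !mxE /=.
- by rewrite -[RHS]e00; ring.
- by rewrite -[RHS]e01; ring.
- by rewrite -[RHS]e10; ring.
- by rewrite -[RHS]e11; ring.
Qed.

(** The form is evaluated at the [i]-th basis vector. *)
Lemma posdef_diag_gt0 m (M : 'M[C]_m) i : hermitian_posdef M -> 0 < M i i.
Proof.
case=> _ /(_ (delta_mx i 0)).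
have -> : M i i = (map_mx Num.conj (delta_mx i (0 : 'I_1))^T *m M *m
                   delta_mx i (0 : 'I_1)) 0 0.
  by rewrite trmx_delta map_delta_mx -rowE -colE !mxE.
by apply; apply/matrix0Pn; exists i, 0; rewrite mxE !eqxx oner_neq0.
Qed.

Lemma posdef_mx2_diag p q : 0 < p -> 0 < q -> hermitian_posdef (mx2 p 0 0 q).
Proof.
move=> p0 q0; split.
  rewrite is_hermitianmxE expr0 scale1r trmxC_mx2 !rmorph0.
  by rewrite !conj_Creal ?gtr0_real.
move=> v v0.
have -> : (map_mx Num.conj v^T *m mx2 p 0 0 q *m v) 0 0 =
    p * `|v 0 0| ^+ 2 + q * `|v 1 0| ^+ 2.
  rewrite !normCK !mxE !big_ord_recl !big_ord0 !mxE !big_ord_recl !big_ord0.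
  rewrite !mxE /=.
  have -> : lift ord0 ord0 = 1 :> 'I_2 by exact: val_inj.
  have -> : ord0 = 0 :> 'I_2 by exact: val_inj.
  ring.
have n2 x : 0 <= `|x| ^+ 2 by exact: exprn_ge0.
rewrite lt0r addr_ge0 ?mulr_ge0 ?(ltW p0) ?(ltW q0) // andbT.
apply: contra v0; rewrite paddr_eq0 ?mulr_ge0 ?(ltW p0) ?(ltW q0) //.
rewrite !mulf_eq0 (gt_eqF p0) (gt_eqF q0) /= !orbb !normr_eq0.
case/andP=> /eqP v00 /eqP v10; apply/eqP/colP => i; rewrite mxE.
by case: i => -[|[|//]] ?; [rewrite -v00|rewrite -v10]; congr (v _ _);
  exact: val_inj.
Qed.

(** As [t] has modulus 1, the action of diag(-t, t) on forms fixes the diagonal entries of [M] and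
    negates the others, which must therefore vanish in characteristic 0. *)
Lemma unitary_rel_tau t (M : 'M[C]_2) : t * t^* = 1 ->
  unitary_rel (mx2 (-1 * t) 0 0 t) M -> M = mx2 (M 0 0) 0 0 (M 1 1).
Proof.
have mxE2 : M = mx2 (M 0 0) (M 0 1) (M 1 0) (M 1 1).
  by apply: mx2P; rewrite !mxE.
have antif x y : t * t^* = 1 -> y = x * (t * t^*) -> x = - y -> x = 0.
  move=> -> ->; rewrite mulr1 => /eqP; rewrite -addr_eq0 -mulr2n.
  by rewrite mulrn_eq0 => /eqP.
move=> t1; rewrite {1}mxE2 /unitary_rel trmxC_mx2 !mul_mx2 => /matrixP e.
have := (e 0 1, e 1 0); rewrite !mxE /= !rmorphM !rmorphN !rmorph1 !rmorph0.
case=> e01 e10; rewrite [LHS]mxE2; congr mx2.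
  by apply: (antif _ (M 0 1 * (t * t^*))) => //; rewrite -[LHS]e01; ring.
by apply: (antif _ (M 1 0 * (t * t^*))) => //; rewrite -[LHS]e10; ring.
Qed.

Lemma necklace_unitary_params a c d p q :
    c = a ^+ 2 - a * d + d ^+ 2 -> 0 < p -> 0 < q ->
    unitary_rel (mx2 a 1 c d) (mx2 p 0 0 q) ->
  [/\ `|a| < 1, `|a - d| = 1 & d * (a - d)^* + d^* * (a - d) = -1].
Proof.
move=> cE p0 q0 /unitary_rel_mx2; rewrite !rmorph1 !mulr1 !mul1r.
case=> e00 e01 e10 e11.
have pn0 : p != 0 by rewrite gt_eqF.
have qn0 : q != 0 by rewrite gt_eqF.
set u := a - d; have aE : a = d + u by rewrite addrC subrK.
clearbody u.
have cuE : c = u ^+ 2 + a * d by rewrite cE aE; ring.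
have qE : q = p * (1 - a * a^*) by rewrite mulrBr mulr1 -[X in X - _]e00; ring.
have qa : a * c^* + (1 - a * a^*) * d^* = 0.
  by apply: (mulfI pn0); rewrite mulr0 -[RHS]e01 qE; ring.
have u1 : u * u^* = 1.
  have : (u * u^*) ^+ 2 = 1.
    apply: (mulfI (mulf_neq0 pn0 qn0)); rewrite mulr1.
    (* This is the determinant of S M S*, for S the image of sigma; its entries are the left-hand
       sides of the four equations. It equals p q |a d - c|^2, where c - a d = u^2. *)
    transitivity ((p * (a * a^*) + q) * (p * (c * c^*) + q * (d * d^*))
      - (p * (a * c^*) + q * d^*) * (p * (c * a^*) + q * d)); last first.
      by rewrite e00 e01 e11 mul0r subr0.
    have -> : (u * u^*) ^+ 2 = (c - a * d) * (c^* - a^* * d^*).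
      by rewrite cuE !rmorphD !rmorphXn !rmorphM /=; ring.
    ring.
  by move/eqP; rewrite -normCK -exprM pexpr_eq1 // => /eqP ->; rewrite expr1n.
split.
- rewrite -(@expr_lt1 _ 2) // normCK -subr_gt0.
  by rewrite -(pmulr_rgt0 _ p0) -qE.
- by apply/eqP; rewrite -sqrp_eq1 // normCK u1.
move: qa; rewrite cuE aE !rmorphD !rmorphXn !rmorphM !rmorphD /= => qa.
(* Once c is expanded, the terms in |a|^2 cancel in [qa]. The factor [u] then pairs with its
   conjugate to give 1. *)
have : u * (u^* ^+ 2 * (d + u) + d^*) = 0.
  by rewrite -[RHS](mulr0 u) -[in RHS]qa; ring.
have -> : u * (u^* ^+ 2 * (d + u) + d^*) =
  (u * u^*) * (d * u^* + u * u^*) + u * d^* by ring.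
rewrite u1 mul1r => /eqP h; apply/eqP; rewrite -subr_eq0 opprK -[0](eqP h).
by apply/eqP; ring.
Qed.

(** Here [s] is the sign (-1)^i, real and its own inverse, so that one computation covers every
    sigma_i. *)
Lemma necklace_params_unitary a c d s :
    c = a ^+ 2 - a * d + d ^+ 2 -> s * s = 1 -> s^* = s ->
    `|a - d| = 1 -> d * (a - d)^* + d^* * (a - d) = -1 ->
  unitary_rel (mx2 a s (c * s) d) (mx2 1 0 0 (1 - a * a^*)).
Proof.
move=> cE s1 sr; set u := a - d; have aE : a = d + u by rewrite addrC subrK.
clearbody u.
move/(congr1 (fun x => x ^+ 2)); rewrite normCK expr1n => u1 du.
have cuE : c = u ^+ 2 + a * d by rewrite cE aE; ring.
(* Multiplying the last hypothesis by u gives a = - u^2 conj d, whence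
   |a| = |d| and c = u^2 (1 - |d|^2). *)
have auE : a = - (u ^+ 2 * d^*).
  apply/eqP; rewrite -addr_eq0 aE; apply/eqP.
  transitivity (u * (d * u^* + d^* * u + 1) + d * (1 - u * u^*)).
    by ring.
  by rewrite du u1; ring.
have acE : a^* = - (u^* ^+ 2 * d).
  by rewrite auE rmorphN rmorphM rmorphXn /= conjCK.
have aa : a * a^* = d * d^*.
  by rewrite acE auE; transitivity ((u * u^*) ^+ 2 * (d * d^*));
    [ring|rewrite u1; ring].
have cdE : c = u ^+ 2 * (1 - d * d^*) by rewrite cuE auE; ring.
have ccE : c^* = u^* ^+ 2 * (1 - d * d^*).
  by rewrite cdE rmorphM rmorphXn rmorphB rmorph1 rmorphM /= conjCK; ring.
have u2 : u ^+ 2 * u^* ^+ 2 = 1 by rewrite -exprMn u1 expr1n.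
apply/unitary_rel_mx2; rewrite rmorphM /= sr aa ccE; split.
- by rewrite s1; ring.
(* Both off-diagonal equations factor through 1 - |u|^4, which is 0. *)
- transitivity (s * d^* * (1 - d * d^*) * (1 - u ^+ 2 * u^* ^+ 2)).
    by rewrite auE; ring.
  by rewrite u2; ring.
- transitivity (s * d * (1 - d * d^*) * (1 - u ^+ 2 * u^* ^+ 2)).
    by rewrite acE cdE; ring.
  by rewrite u2; ring.
- transitivity ((s * s) * (u ^+ 2 * u^* ^+ 2) * (1 - d * d^*) ^+ 2
                + (1 - d * d^*) * (d * d^*)); first by rewrite cdE; ring.
  by rewrite s1 u2; ring.
Qed.

End TwoByTwo.

(** * Angles modulo 2 pi and the unit circle *)

Section Angles.
Variable R : realType.
Implicit Types x y : R.

Lemma eqmod2pi_cos_sin x y :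
  eqmod2pi x y -> cos x = cos y /\ sin x = sin y.
Proof.
case=> k ->; have pE n : n%:R * (2 * pi) = (pi *+ 2) *+ n :> R.
  by rewrite !mulr_natl.
have nat_period z n : cos (z + n%:R * (2 * pi)) = cos z /\
    sin (z + n%:R * (2 * pi)) = sin z :> R.
  by rewrite pE; split; apply: periodicn; [exact: cosD2pi|exact: sinD2pi].
case: k => n; first exact: nat_period.
(* For a negative multiple, adding n + 1 periods to the shifted angle leads back to [y]. *)
have := nat_period (y + (Negz n)%:~R * (2 * pi)) n.+1.
by rewrite NegzE mulrNz mulNr addrNK => -[-> ->].
Qed.

(** Reduce [x] to [z] in [0, 2 pi). Cosine is injective on [0, pi]; if z > pi, then 2 pi - z lies in
    that interval with the same cosine, which would force z = 2 pi. *)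
Lemma cos_eq1_mod2pi x : cos x = 1 -> eqmod2pi x 0.
Proof.
have pi2 : 0 < 2 * pi :> R by rewrite mulr_gt0 ?pi_gt0.
pose k := Num.floor (x / (2 * pi)); pose z := x - k%:~R * (2 * pi).
have zx : eqmod2pi x z by exists k; rewrite /z subrK.
have /andP[z0 z2] : 0 <= z < 2 * pi.
  rewrite /z subr_ge0 ltrBlDl -[X in _ + X]mul1r -mulrDl -[1]/(1%:~R) -intrD.
  by rewrite -ler_pdivlMr // -ltr_pdivrMr // floor_itv.
have [-> _] := eqmod2pi_cos_sin _ _ zx.
rewrite -cos0 => cz; exists k; rewrite add0r; apply/eqP; rewrite -subr_eq0.
have pi0 := @pi_ge0 R.
have [zpi|piz] := lerP z pi; apply/eqP.
  by apply: cos_inj cz; rewrite in_itv /= ?lexx ?z0.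
suff : 2 * pi - z = 0 by move=> e; move: z2; rewrite -subr_gt0 e ltxx.
apply: cos_inj; rewrite ?in_itv /= ?lexx ?pi0 //.
  by apply/andP; split; lra.
rewrite -cz -cosN opprB -[LHS]cosD2pi; congr cos; ring.
Qed.

(** The sine is 1 or -1, so a shift by a quarter turn gives an angle of cosine 1. *)
Lemma cos_eq0_mod2pi x :
  cos x = 0 -> eqmod2pi x (pi / 2) \/ eqmod2pi x (- (pi / 2)).
Proof.
move=> cx; have := sin2cos2 x; rewrite cx expr0n subr0 => /eqP.
rewrite sqrf_eq1 => /orP[] /eqP sx; [left|right].
  have [k xk] : eqmod2pi (x - pi / 2) 0.
    by apply: cos_eq1_mod2pi; rewrite cosBpihalf.
  by exists k; move: xk; rewrite add0r => <-; rewrite addrC subrK.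
have [k xk] : eqmod2pi (x + pi / 2) 0.
  by apply: cos_eq1_mod2pi; rewrite cosDpihalf sx opprK.
by exists k; move: xk; rewrite add0r => <-; rewrite addrC addrK.
Qed.

(** The arccosine of the real part parametrizes the upper half circle; its opposite serves when the
    imaginary part is negative. *)
Lemma norm1_expi (u : R[i]) : `|u| = 1 -> exists theta, u = expi theta.
Proof.
case: u => x y; rewrite normc_def /= => -[/eqP].
rewrite -sqrp_eq1 ?sqrtr_ge0 // sqr_sqrtr ?addr_ge0 ?sqr_ge0 // => /eqP xy.
have y2 : y ^+ 2 = 1 - x ^+ 2 by rewrite -xy addrC addKr.
have x1 : -1 <= x <= 1.
  by rewrite -ler_norml -(@expr_le1 _ 2) // real_normK ?num_real // -subr_ge0
    -y2 sqr_ge0.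
have cx : cos (acos x) = x by rewrite acosK // in_itv.
have sx : sin (acos x) = `|y| by rewrite sin_acos // -y2 sqrtr_sqr.
have [y0|y0] := lerP 0 y.
  by exists (acos x); rewrite /expi cx sx ger0_norm.
by exists (- acos x); rewrite /expi cosN sinN cx sx ltr0_norm // opprK.
Qed.

Lemma norm_expi x : `|expi x| = 1.
Proof. by rewrite normc_def /= cos2Dsin2 sqrtr1. Qed.

(** A number plus its conjugate is real: the condition on [d] becomes one real linear equation in
    its two coordinates. *)
Lemma conj_expi_add (d : R[i]) x :
  d * Num.conj (expi x) + Num.conj d * expi x =
  (2 * (complex.Re d * cos x + complex.Im d * sin x))%:C.
Proof.
case: d => p q; rewrite /expi /=; apply/eqP; rewrite eq_complex /=.
by apply/andP; split; apply/eqP; ring.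
Qed.

(* The three cases describe the single line [2 Re (d e^(-i theta)) = -1]. *)
Lemma expi_line_cases (d : R[i]) x :
  d * Num.conj (expi x) + Num.conj d * expi x = -1 <->
  [/\ eqmod2pi x (pi / 2) -> exists r : R, d = r +i* (- (1 / 2)),
      eqmod2pi x (- (pi / 2)) -> exists r : R, d = r +i* (1 / 2)
    & ~ eqmod2pi x (pi / 2) -> ~ eqmod2pi x (- (pi / 2)) ->
      exists r : R, d = (- (1 / 2) * sec x - tan x * r) +i* r].
Proof.
have realE : d * Num.conj (expi x) + Num.conj d * expi x = -1 <->
    2 * (complex.Re d * cos x + complex.Im d * sin x) = -1.
  by rewrite conj_expi_add; split=> [[->]|->] //; rewrite rmorphN rmorph1.
rewrite {}realE; case: d => p q /=.
have half : eqmod2pi x (pi / 2) -> cos x = 0 /\ sin x = 1.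
  by case/eqmod2pi_cos_sin => -> ->; rewrite cos_pihalf sin_pihalf.
have halfN : eqmod2pi x (- (pi / 2)) -> cos x = 0 /\ sin x = -1.
  by case/eqmod2pi_cos_sin => -> ->; rewrite cosN sinN cos_pihalf sin_pihalf.
split=> [line|[hp hn hs]].
  split.
  - by case/half => c0 s1; exists p; congr Complex; move: line;
    rewrite c0 s1; lra.
  - by case/halfN => c0 s1; exists p; congr Complex; move: line;
    rewrite c0 s1; lra.
  (* The free parameter is the imaginary part of [d]; as [cos x] is nonzero, the line equation
     determines the real part. *)
  - move=> np nn; exists q; congr Complex; rewrite /sec /tan.
    have c0 : cos x != 0 by apply/eqP => /cos_eq0_mod2pi[].
    apply: (mulIf c0); transitivity (- (1 / 2) - sin x * q); first by lra.
    by field.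
have [xp|np] := pselect (eqmod2pi x (pi / 2)).
  by have [c0 s1] := half xp; have [r [_ ->]] := hp xp; rewrite c0 s1; lra.
have [xn|nn] := pselect (eqmod2pi x (- (pi / 2))).
  by have [c0 s1] := halfN xn; have [r [_ ->]] := hn xn; rewrite c0 s1; lra.
have c0 : cos x != 0 by apply/eqP => /cos_eq0_mod2pi[].
have [r [-> ->]] := hs np nn; rewrite /sec /tan; by field.
Qed.

End Angles.

(** * Unitarizability in terms of the parameters *)

Theorem proposition4p2 (R : realType) (t a c d : R[i])
    (rho : {multiplicative NB 4 -> GL 2 R[i]}) :
    t ^+ 8 = 1 ->
    c = a ^+ 2 - a * d + d ^+ 2 ->
    c != 0 ->
    a != d ->
    is_necklace_rep (-1) t a c d rho ->
  (exists M : 'M[R[i]]_2, hermitian_posdef M /\ unitary_rep_rel rho M)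
  <->
  (`|a| < 1 /\
   exists theta : R,
     [/\ a = d + expi theta,
         eqmod2pi theta (pi / 2) ->
           exists delta' : R, d = delta' +i* (- (1 / 2)),
         eqmod2pi theta (- (pi / 2)) ->
           exists delta' : R, d = delta' +i* (1 / 2)
       & ~ eqmod2pi theta (pi / 2) -> ~ eqmod2pi theta (- (pi / 2)) ->
           exists delta : R,
             d = (- (1 / 2) * sec theta - tan theta * delta) +i* delta]).
Proof.
move=> t8 cE _ _ [rhot rhos].
have t1 : t * Num.conj t = 1.
  rewrite -normCK; have /eqP : `|t| ^+ 8 = 1 by rewrite -normrX t8 normr1.
  by rewrite pexpr_eq1 // => /eqP ->; rewrite expr1n.
split.
- case=> M [Mpos Mu]; have p0 := posdef_diag_gt0 _ _ _ 0 Mpos.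
  have q0 := posdef_diag_gt0 _ _ _ 1 Mpos.
  have := Mu (tau 4); rewrite rhot => /(unitary_rel_tau _ _ _ t1) ME.
  (* At index 0 the powers of -1 are trivial, so the equations carry no sign; this generator and tau
     yield all the necessary conditions. *)
  have := Mu (sigma (0 : 'I_4)); rewrite rhos expr0 invr1 mulr1 ME.
  case/(necklace_unitary_params _ _ _ _ _ _ cE p0 q0) => a1.
  case/norm1_expi=> theta ad line.
  split=> //; exists theta; rewrite ad in line.
  by case/expi_line_cases: line => ? ? ?; split; rewrite // -ad addrC subrK.
case=> a1 [theta [ad h1 h2 h3]].
have adE : a - d = expi theta by rewrite ad addrC addKr.
have line : d * Num.conj (a - d) + Num.conj d * (a - d) = -1.
  by rewrite adE; apply/expi_line_cases; split.
have q0 : 0 < 1 - a * Num.conj a by rewrite -normCK subr_gt0 expr_lt1.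
exists (mx2 1 0 0 (1 - a * Num.conj a)); split.
  exact: posdef_mx2_diag.
apply: unitary_rep_generators => -[i|].
  (* As -1 is its own inverse, both off-diagonal entries carry the same sign (-1)^i. *)
  rewrite rhos -exprVn invrN1.
  apply: necklace_params_unitary => //; last by rewrite adE norm_expi.
    by rewrite -exprMn mulrNN mulr1 expr1n.
  by rewrite rmorphXn rmorphN rmorph1.
(* For tau, everything is diagonal and the diagonal entries -t and t have modulus 1. *)
rewrite rhot; apply/unitary_rel_mx2.
rewrite !rmorph0 !rmorphM !rmorphN !rmorph1 !mulr0 !mul0r !add0r !addr0.
rewrite /= mul1r mulrACA mulrNN !mulr1 t1 !mulr0.
by split; rewrite ?mulr1.
Qed.
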